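(* For every $\delta>0$ there exists $m_0$ such that every triangle-free graph $G$ with $m\ge m_0$ edges satisfies $$\chi_f(G)\le (18^{1/3}+\delta)\frac{m^{1/3}}{(\ln m)^{2/3}}.$$
   Context: The fractional chromatic number $\chi_f(G)$ of a finite graph $G$ is the minimum real number $r\ge 1$ such that there exists a probability distribution on the independent sets of $G$ under which a random independent set contains every vertex $v\in V(G)$ with probability at least $1/r$. A graph is triangle-free if it contains no three pairwise adjacent vertices. *)

(* Defs.v *)
From HB Require Import structures.
From mathcomp Require Import all_boot all_order all_algebra.
From mathcomp Require Import all_classical all_reals.
From mathcomp Require Import topology normedtype derive.
Set Implicit Arguments.
Unset Strict Implicit.
Unset Printing Implicit Defensive.
Import Order.TTheory GRing.Theory Num.Theory.
Import numFieldNormedType.Exports.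
Local Open Scope ring_scope.

Record sgraph := SGraph {
  vertex :> finType;
  adj : rel vertex;
  adj_sym : symmetric adj;
  adj_irrefl : irreflexive adj }.

Definition edges (G : sgraph) : {set {set G}} :=
  [set [set p.1; p.2]%SET | p : G * G & adj p.1 p.2]%SET.

Definition triangle_free (G : sgraph) : Prop :=
  forall x y z : G, ~ [/\ adj x y, adj y z & adj x z].

Definition independent (G : sgraph) (I : {set G}) : bool :=
  [forall x in I, forall y in I, ~~ adj x y].

Definition indep_distr (R : realType) (G : sgraph) (P : {ffun {set G} -> R}) :
    Prop :=
  [/\ forall I, 0 <= P I,
      forall I, ~~ independent I -> P I = 0 &
      \sum_I P I = 1].

Definition frac_colorable (R : realType) (G : sgraph) (r : R) : Prop :=
  1 <= r /\
  exists2 P : {ffun {set G} -> R}, indep_distr P &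
    forall v : G, r^-1 <= \sum_(I : {set G} | v \in I) P I.

(* The infimum is a minimum, see chi_f_min below. *)
Definition chi_f (R : realType) (G : sgraph) : R :=
  inf [set r : R | frac_colorable G r]%classic.

Lemma frac_colorable_best (R : realType) (G : sgraph) :
  exists r : R, frac_colorable G r /\ forall s, frac_colorable G s -> r <= s.
Proof.
set n := #|{set G}|.
pose P (x : 'rV[R]_n) : {ffun {set G} -> R} := [ffun I => x ord0 (enum_rank I)].
pose row (Q : {ffun {set G} -> R}) : 'rV[R]_n := \row_i Q (enum_val i).
have rowK Q : P (row Q) = Q by apply/ffunP => I; rewrite !ffunE mxE enum_rankK.
pose K := [set x : 'rV[R]_n | indep_distr (P x)]%classic.
pose cov (v : G) (x : 'rV[R]_n) : R := \sum_(I : {set G} | v \in I) P x I.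
pose f (x : 'rV[R]_n) : R := \big[Order.min/1]_v cov v x.
have cP I : continuous (fun x => P x I : R).
  have -> : (fun x => P x I : R) = (fun x => x ord0 (enum_rank I)).
    by apply/funext => x; rewrite ffunE.
  exact: coord_continuous.
have csum (p : pred {set G}) : continuous (fun x => \sum_(I | p I) P x I : R).
  apply: continuous_big => [|I _]; last exact: cP.
  exact: add_continuous.
have cf : continuous f.
  apply: continuous_big => [|v _]; last exact: csum.
  exact: min_continuous.
have K01 x I : K x -> 0 <= P x I <= 1.
  move=> [P0 _ P1]; rewrite P0 /= -P1 (bigD1 I) //= lerDl.
  by apply: sumr_ge0 => J _; exact: P0.
have cK : compact K.
  apply: (@subclosed_compact _ _
      [set x : 'rV[R]_n | forall i, `[0, 1]%classic (x ord0 i)]%classic).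
  - have -> : (K = (\bigcap_I [set x | 0 <= P x I]) `&`
        (\bigcap_(I in [set I | ~~ independent I]) [set x | P x I = 0]) `&`
        [set x | \sum_I P x I = 1])%classic.
      apply/seteqP; split=> x /=.
        by move=> [P0 Pi P1]; split=> //; split=> I pI; [exact: P0|exact: Pi].
      by move=> [[P0 Pi] P1]; split=> [I|I pI|//]; [exact: P0|exact: Pi].
    apply: closedI; first apply: closedI.
    + apply: closed_bigI => I _.
      apply: (preimage_closed (f := fun x => P x I : R)) (@closed_ge R 0).
      by move=> x _; exact: cP.
    + apply: closed_bigI => I _.
      apply: (preimage_closed (f := fun x => P x I : R)) (@closed_eq R 0).
      by move=> x _; exact: cP.
    + apply: (preimage_closed (f := fun x => \sum_I P x I : R)) (@closed_eq R 1).
      by move=> x _; exact: csum.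
  - by apply: (@rV_compact R n (fun=> `[0, 1]%classic)) => _; exact: segment_compact.
  - move=> x Kx i; have := K01 x (enum_val i) Kx.
    by rewrite ffunE enum_valK /= in_itv.
pose N := #|[set I : {set G} | (#|I| <= 1)%N]|.
have N0 : 0 < N%:R :> R.
  by rewrite ltr0n; apply/card_gt0P; exists finset.set0; rewrite inE cards0.
pose U : {ffun {set G} -> R} := [ffun I : {set G} => (#|I| <= 1)%N%:R / N%:R].
have KU : K (row U).
  rewrite /K /= rowK; split.
  - by move=> I; rewrite ffunE divr_ge0 // ltW.
  - move=> I /forall_inPn[x xI /forall_inPn[y yI /negPn xy]].
    rewrite ffunE leqNgt; case: ltnP; rewrite ?mul0r // => /card_le1_eqP/(_ _ _ xI yI) exy.
    by move: xy; rewrite exy adj_irrefl.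
  - under eq_bigr do rewrite ffunE.
    rewrite -mulr_suml -natr_sum -big_mkcond sum1dep_card divff ?gt_eqF //.
have fU : 0 < f (row U).
  apply: lt_bigmin => // v _; rewrite /cov rowK (bigD1 [set v]%SET) ?inE //=.
  rewrite ffunE cards1 leqnn mul1r ltr_pwDl ?invr_gt0 //.
  by apply: sumr_ge0 => I _; rewrite ffunE divr_ge0 // ltW.
have [c] := EVT_max_rV (ex_intro _ _ KU) cK (continuous_subspaceT cf).
rewrite inE => Kc cmax.
have fc0 : 0 < f c by apply: lt_le_trans fU _; apply: cmax; rewrite inE.
exists (f c)^-1; split.
  split; first by rewrite invf_ge1 // bigmin_le_id.
  by exists (P c) => // v; rewrite invrK; exact: bigmin_le.
move=> s [s1 [Q Qd Qs]]; have s0 : 0 < s by apply: lt_le_trans s1.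
rewrite -[s]invrK lef_pV2 ?posrE ?invr_gt0 //.
apply: (@le_trans _ _ (f (row Q))); last by apply: cmax; rewrite inE /K /= rowK.
by apply: le_bigmin => [|v _]; [rewrite invf_le1 | rewrite /cov rowK].
Qed.

Lemma chi_f_min (R : realType) (G : sgraph) :
  frac_colorable G (chi_f R G) /\
  forall s : R, frac_colorable G s -> chi_f R G <= s.
Proof.
have [r [rc rmin]] := frac_colorable_best R G.
suff -> : chi_f R G = r by [].
apply/eqP; rewrite eq_le; apply/andP; split.
  by apply: ge_inf => //; exists r => s /rmin.
by apply: lb_le_inf; [exists r | move=> s /rmin].
Qed.

(* Main.v *)
Require Import Defs.
From HB Require Import structures.
From mathcomp Require Import all_boot all_order all_algebra.
From mathcomp Require Import all_classical all_reals.
From mathcomp Require Import topology normedtype sequences derive exp.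
From mathcomp Require Import ring lra.
Set Implicit Arguments.
Unset Strict Implicit.
Unset Printing Implicit Defensive.
Import Order.TTheory GRing.Theory Num.Theory.
Import numFieldNormedType.Exports.
Local Open Scope ring_scope.

(**
If [G] has no fractional colouring of value [rho], LP duality gives a
probability [mu] on the vertices with [mu(I) <= 1/rho] for every independent
[I]; in particular [mu(N(u)) <= 1/rho] because [N(u)] is independent.

The main tool is a weighted form of Shearer's theorem: for [0 <= x <= 1],
  [sum_u mu_u x_u ln X / (K + x(N(u))) <= (1 + 2X/K) max_I mu(I)].
It is obtained from the potential
  [sum_u mu_u x_u (ln X - ln (max x_u 1)) / (K + x(N(u)))]
on the box [[0, X]^V]. At an interior maximum the derivative along
[x_u' = x_u x(N(u))] is nonpositive; triangle-freeness turns this into the statement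
that adding a vertex [v] to the independent set and deleting its neighbourhood,
with [v] chosen with probability proportional to [x_v], does not lose on
average. At a boundary maximum a vertex can be deleted.

Taking [x = min(1, c mu)] bounds [sum mu_u^2] by about [1/(rho^2 L)] and taking
[x = 1] bounds [sum mu_u/d_u] by about [1/(rho L)], where [L ~ ln rho]. By
Hölder, [1 = (sum mu_u)^3 <= (sum mu_u^2)(sum mu_u/d_u)(sum d_u)], so
[2m >= (1 - o(1)) rho^3 L^2], which is the theorem since [L ~ (ln m)/3].
*)

(** * The potential and elementary bounds on the slack *)

Definition nbr_sum {R : realType} {G : sgraph} (x : G -> R) (u : G) : R :=
  \sum_(v | adj u v) x v.

(* The truncation [Num.max z 1] makes [z * slack X z] linear on [0, 1], hence
   continuous at [0]. *)
Definition slack {R : realType} (X z : R) : R := ln X - ln (Num.max z 1).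

Definition pot_term {R : realType} {G : sgraph} (X K : R) (x : G -> R) (u : G) : R :=
  x u * slack X (x u) / (K + nbr_sum x u).

Definition pot {R : realType} {G : sgraph} (mu : G -> R) (X K : R) (x : G -> R) : R :=
  \sum_u mu u * pot_term X K x u.

Lemma slack_ge0 {R : realType} (X z : R) : 1 <= X -> z <= X -> 0 <= slack X z.
Proof.
move=> X1 zX; rewrite subr_ge0 ler_ln ?posrE ?lt_max ?ltr01 ?orbT //; last exact: lt_le_trans X1.
by rewrite ge_max zX X1.
Qed.

Lemma slack_gt0 {R : realType} (X z : R) : 1 < X -> z < X -> 0 < slack X z.
Proof.
move=> X1 zX; rewrite subr_gt0 ltr_ln ?posrE ?lt_max ?ltr01 ?orbT //; last exact: lt_trans X1.
by rewrite gt_max zX X1.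
Qed.

Lemma slack_le1 {R : realType} (X z : R) : z <= 1 -> slack X z = ln X.
Proof. by move=> z1; rewrite /slack max_r // ln1 subr0. Qed.

(** Follows from [ln w < w] at [w = X / max z 1]. It bounds each [pot_term] by [X / K]. *)
Lemma mul_slack_le {R : realType} (X z : R) : 1 <= X -> 0 <= z -> z * slack X z <= X.
Proof.
move=> X1 z0; have X0 : 0 < X by exact: lt_le_trans X1.
pose M := Num.max z 1; have M0 : 0 < M by rewrite lt_max ltr01 orbT.
have zM : z <= M by rewrite le_max lexx.
have h : slack X z < X / M.
  by rewrite /slack -ln_div ?posrE //; apply: ln_sublinear; rewrite divr_gt0.
apply: (@le_trans _ _ (z * (X / M))); first by rewrite ler_wpM2l // ltW.
rewrite mulrCA; rewrite -[leRHS]mulr1 ler_wpM2l ?(ltW X0) //.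
by rewrite ler_pdivrMr // mul1r.
Qed.

(** [max (z (1 + t)) 1 <= (1 + t) max z 1], and [ln (1 + t) <= t]. This one-sided estimate replaces
    a derivative at the kink. *)
Lemma slack_scale {R : realType} (X z t : R) : 0 <= t ->
  slack X z - t <= slack X (z * (1 + t)).
Proof.
move=> t0; have s0 : 0 < 1 + t by rewrite ltr_pwDl.
have M0 : 0 < Num.max z 1 by rewrite lt_max ltr01 orbT.
suff : ln (Num.max (z * (1 + t)) 1) <= ln (Num.max z 1) + t by rewrite /slack; lra.
apply: (@le_trans _ _ (ln (Num.max z 1 * (1 + t)))).
  rewrite ler_ln ?posrE ?mulr_gt0 ?lt_max ?ltr01 ?orbT //.
  rewrite ge_max; apply/andP; split.
    by rewrite ler_wpM2r ?(ltW s0) // le_max lexx.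
  have : 1 <= Num.max z 1 by rewrite le_max lexx orbT.
  by move=> ?; nra.
by rewrite lnM ?posrE // lerD2l le_ln1Dx //; lra.
Qed.

(** * First-order condition at a maximum of the potential *)

Lemma nbr_sum_ge0 {R : realType} {G : sgraph} (x : G -> R) u :
  (forall v, 0 <= x v) -> 0 <= nbr_sum x u.
Proof. by move=> x0; apply: sumr_ge0. Qed.

(** With [b = E / G], the only non-polynomial factor in [t] is [1 / (1 + t b)], which is at least
    [1 - t b]; the hypothesis [t D <= l] keeps the factor it multiplies nonnegative. *)
Lemma flow_term {R : realType} (x D l t G E : R) :
  0 <= x -> 0 <= D -> 0 <= t -> t * D <= l -> 0 < G -> 0 <= E ->
  x * l / G + t * (x * l / G * D - x * D / G - x * l / G ^+ 2 * E)
    - t ^+ 2 * (x * (D ^+ 2 + D * l * E / G) / G)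
  <= x * (1 + t * D) * (l - t * D) / (G + t * E).
Proof.
move=> x0 D0 t0 tDl G0 E0.
have Gn : G != 0 by rewrite gt_eqF.
pose b := E / G; have b0 : 0 <= b by rewrite divr_ge0 // ltW.
have EE : E = b * G by rewrite /b mulfVK.
rewrite EE.
have -> : G + t * (b * G) = G * (1 + t * b) by ring.
have tb0 : 0 <= t * b by rewrite mulr_ge0.
have tD0 : 0 <= t * D by rewrite mulr_ge0.
have s0 : 0 < 1 + t * b by lra.
pose A := (1 + t * D) * (l - t * D).
have A0 : 0 <= A by rewrite mulr_ge0 //; lra.
have -> : x * (1 + t * D) * (l - t * D) / (G * (1 + t * b)) = x / G * (A / (1 + t * b)).
  by rewrite /A; field; rewrite Gn gt_eqF.
(* The subtracted product is nonnegative and cancels the cubic term of [A (1 - t b)], so the error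
   is purely quadratic in [t]. *)
have -> : x * l / G + t * (x * l / G * D - x * D / G - x * l / G ^+ 2 * (b * G))
    - t ^+ 2 * (x * (D ^+ 2 + D * l * (b * G) / G) / G)
  = x / G * (A * (1 - t * b) - (t * b) * (t * D) * (1 + t * D)).
  by rewrite /A; field.
rewrite ler_wpM2l ?divr_ge0 ?(ltW G0) //.
apply: (@le_trans _ _ (A * (1 - t * b))).
  by rewrite gerBl; apply: mulr_ge0; [exact: mulr_ge0 | lra].
rewrite ler_wpM2l // lerBlDr -subr_ge0.
have -> : (1 + t * b)^-1 + t * b - 1 = (t * b) ^+ 2 / (1 + t * b).
  by field; rewrite gt_eqF.
by rewrite divr_ge0 ?sqr_ge0 // ltW.
Qed.

(* First-order optimality in the direction [x u * nbr_sum x u], one-sided because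
   [slack] has a kink at [1]. *)
Lemma pot_flow {R : realType} {G : sgraph} (mu : G -> R) (X K : R) (x : G -> R) :
  1 < X -> 0 < K -> (forall u, 0 <= mu u) -> (forall u, 0 <= x u < X) ->
  (forall y : G -> R, (forall u, 0 <= y u <= X) ->
     (forall u, x u = 0 -> y u = 0) -> pot mu X K y <= pot mu X K x) ->
  \sum_u mu u * (pot_term X K x u * nbr_sum x u - x u * nbr_sum x u / (K + nbr_sum x u)
     - x u * slack X (x u) / (K + nbr_sum x u) ^+ 2
         * nbr_sum (fun v => x v * nbr_sum x v) u) <= 0.
Proof.
move=> X1 K0 mu0 xX xmax.
have x0 u : 0 <= x u by case/andP: (xX u).
pose D := nbr_sum x; pose E := nbr_sum (fun v => x v * D v).
have D0 u : 0 <= D u by exact: nbr_sum_ge0.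
have E0 u : 0 <= E u by apply: nbr_sum_ge0 => v; rewrite mulr_ge0.
pose l u := slack X (x u); pose H u := K + D u.
have H0 u : 0 < H u by rewrite /H ltr_pwDl.
pose c u := x u * l u / H u * D u - x u * D u / H u - x u * l u / H u ^+ 2 * E u.
pose C u := x u * (D u ^+ 2 + D u * l u * E u / H u) / H u.
change (\sum_u mu u * c u <= 0).
rewrite leNgt; apply/negP => s0.
pose s := \sum_u mu u * c u; pose S := \sum_u mu u * C u.
have small a b d : a < b -> \forall t \near ((0 : R)^'+)%classic, a + t * d <= b.
  have d0 : 0 < `|d| + 1 by rewrite ltr_wpDl.
  move=> ab; near=> t.
  have t0 : 0 < t by near: t; exact: nbhs_right_gt.
  have tb : t < (b - a) / (`|d| + 1).
    by near: t; apply: nbhs_right_lt; apply: divr_gt0 => //; rewrite subr_gt0.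
  have : t * (`|d| + 1) < b - a by rewrite -ltr_pdivlMr.
  have : d <= `|d| by exact: ler_norm.
  move=> h1 h2; nra.
(* Such a [t] keeps the moved point in the box, meets the hypothesis of [flow_term], and makes the
   gain [t s] exceed the error [t^2 S]. *)
have : \forall t \near ((0 : R)^'+)%classic, [/\ 0 < t, forall u, x u + t * (x u * D u) <= X,
    forall u, 0 + t * D u <= l u & 0 + t * (S + 1) <= s].
  near=> t; split.
  - by near: t; exact: nbhs_right_gt.
  - by near: t; apply: filter_forall => u; apply: small; case/andP: (xX u).
  - near: t; apply: filter_forall => u; apply: small; apply: slack_gt0 => //.
    by case/andP: (xX u).
  - by near: t; apply: small.
move=> /filter_ex[t [t0 tX tl ts]].
pose y u := x u * (1 + t * D u).
have tD u : 0 <= t * D u by rewrite mulr_ge0 // ltW.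
have y0 u : 0 <= y u by rewrite mulr_ge0 // addr_ge0.
have yX u : 0 <= y u <= X.
  by rewrite y0 /=; have := tX u; rewrite /y; lra.
have ysupp u : x u = 0 -> y u = 0 by rewrite /y => ->; rewrite mul0r.
have := xmax y yX ysupp; apply/negP; rewrite -ltNge.
have ny u : K + nbr_sum y u = H u + t * E u.
  rewrite /H -addrA; congr (_ + _); rewrite /E /D /nbr_sum mulr_sumr -big_split /=.
  by apply: eq_bigr => v _; rewrite /y /D /nbr_sum; ring.
have key u : pot_term X K x u + t * c u - t ^+ 2 * C u <= pot_term X K y u.
  apply: (@le_trans _ _ (x u * (1 + t * D u) * (l u - t * D u) / (H u + t * E u))).
    by apply: flow_term => //; [exact: ltW | have := tl u; rewrite add0r | exact: H0].
  rewrite /pot_term ny; apply: ler_wpM2r; last by apply: ler_wpM2l; [exact: y0 | exact: slack_scale].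
  by rewrite invr_ge0 addr_ge0 ?(ltW (H0 u)) // mulr_ge0 // ltW.
apply: (@lt_le_trans _ _ (\sum_u mu u * (pot_term X K x u + t * c u - t ^+ 2 * C u))).
  have -> : \sum_u mu u * (pot_term X K x u + t * c u - t ^+ 2 * C u)
      = pot mu X K x + t * s - t ^+ 2 * S.
    rewrite /pot /s /S !mulr_sumr -big_split -sumrB /=.
    by apply: eq_bigr => u _; ring.
  by rewrite -addrA ltrDl expr2 -mulrA -mulrBr mulr_gt0 //; lra.
by apply: ler_sum => u _; rewrite ler_wpM2l.
Unshelve. all: by end_near. Qed.

(** * Deleting a closed neighbourhood *)

Definition del_nbhd {R : realType} {G : sgraph} (v : G) (x : G -> R) (u : G) : R :=
  if (u == v) || adj u v then 0 else x u.

Lemma nbr_sum_del {R : realType} {G : sgraph} (x : G -> R) (u v : G) :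
  ~~ adj u v ->
  nbr_sum (del_nbhd v x) u = nbr_sum x u - \sum_(w | adj u w && adj w v) x w.
Proof.
move=> uv; rewrite /nbr_sum [in RHS](bigID (fun w => adj w v)) /= [_ - _]addrC addKr.
rewrite (bigID (fun w => adj w v)) /= big1 ?add0r; last first.
  by move=> w /andP[_ wv]; rewrite /del_nbhd wv orbT.
apply: eq_bigr => w /andP[uw /negPf wv]; rewrite /del_nbhd wv orbF.
by case: eqP => // ewv; rewrite -ewv uw in uv.
Qed.

(** By convexity the reciprocal lies above its tangent at [H]. *)
Lemma inv_sub_ge {R : realType} (H c : R) : 0 < H -> c < H ->
  H^-1 + c / H ^+ 2 <= (H - c)^-1.
Proof.
move=> H0 cH; have Hc : 0 < H - c by lra.
rewrite -subr_ge0.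
have -> : (H - c)^-1 - (H^-1 + c / H ^+ 2) = c ^+ 2 / (H ^+ 2 * (H - c)).
  by field; rewrite !gt_eqF.
by rewrite divr_ge0 ?sqr_ge0 // mulr_ge0 ?sqr_ge0 // ltW.
Qed.

(* Triangle-freeness makes the common-neighbour sum vanish when [u] and [v] are
   adjacent, so that it can be kept there at no cost. *)
Lemma pot_term_del {R : realType} {G : sgraph} (X K : R) (x : G -> R) (u v : G) :
  triangle_free G -> 1 <= X -> 0 < K -> (forall w, 0 <= x w <= X) ->
  pot_term X K x u
   + x u * slack X (x u) / (K + nbr_sum x u) ^+ 2 * \sum_(w | adj u w && adj w v) x w
   - (adj u v)%:R * pot_term X K x u - (u == v)%:R * (2 * pot_term X K x u)
  <= pot_term X K (del_nbhd v x) u.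
Proof.
move=> Gtf X1 K0 xX; have x0 w : 0 <= x w by case/andP: (xX w).
have n0 := nbr_sum_ge0 u x0.
have H0 : 0 < K + nbr_sum x u by rewrite ltr_pwDl.
have a0 : 0 <= x u * slack X (x u).
  by rewrite mulr_ge0 // slack_ge0 //; case/andP: (xX u).
have c0 : 0 <= \sum_(w | adj u w && adj w v) x w by apply: sumr_ge0.
(* For [u = v] the common-neighbour sum is all of [nbr_sum x u], so it adds at most one more
   [pot_term]; hence the factor 2 in the correction. *)
have [euv|nuv] := eqVneq u v.
  rewrite -euv adj_irrefl !mul0r mul1r subr0.
  have -> : pot_term X K (del_nbhd u x) u = 0.
    by rewrite /pot_term {1}/del_nbhd eqxx !mul0r.
  have -> : \sum_(w | adj u w && adj w u) x w = nbr_sum x u.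
    by apply: eq_bigl => w; rewrite (adj_sym w u) andbb.
  rewrite /pot_term; set H := K + _ in H0 *; set a := x u * _ in a0 *.
  have -> : a / H + a / H ^+ 2 * nbr_sum x u - 2 * (a / H) = - (a * K / H ^+ 2).
    rewrite (_ : nbr_sum x u = H - K); last by rewrite /H; ring.
    by field; rewrite gt_eqF.
  by rewrite oppr_le0 divr_ge0 ?sqr_ge0 // mulr_ge0 // ltW.
rewrite mul0r subr0; case: (boolP (adj u v)) => uv.
  rewrite big_pred0 => [|w]; last first.
    by apply/negP => /andP[uw wv]; apply: (Gtf u w v).
  by rewrite /pot_term /del_nbhd uv orbT !mul0r mulr0 addr0 mul1r subrr.
rewrite mul0r subr0 /pot_term nbr_sum_del // /del_nbhd (negPf nuv) (negPf uv) /= addrA.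
set c := \sum_(w | _) _ in c0 *; set H := K + _ in H0 *; set a := x u * _ in a0 *.
rewrite (_ : a / H + a / H ^+ 2 * c = a * (H^-1 + c / H ^+ 2)); last by ring.
rewrite ler_wpM2l // inv_sub_ge //.
rewrite ltr_pwDl // /nbr_sum [leRHS](bigID (fun w => adj w v)) /= lerDl.
by apply: sumr_ge0.
Qed.

Lemma pot_term_le {R : realType} {G : sgraph} (X K : R) (x : G -> R) u :
  1 <= X -> 0 < K -> (forall w, 0 <= x w) -> pot_term X K x u <= X / K.
Proof.
move=> X1 K0 x0; have n0 := nbr_sum_ge0 u x0.
rewrite ler_pdivrMr ?ltr_pwDl //.
apply: (le_trans (mul_slack_le X1 (x0 u))).
have X0 : 0 < X by exact: lt_le_trans X1.
by rewrite mulrDr divfK ?gt_eqF // lerDl mulr_ge0 // divr_ge0 // ltW.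
Qed.

(** The inequality is proved on average over [v] with weights [x v], by summing [pot_term_del] over
    [v] and adding [pot_flow]. *)
Lemma pot_pick {R : realType} {G : sgraph} (mu : G -> R) (X K : R) (x : G -> R) :
  triangle_free G -> 1 < X -> 0 < K -> (forall u, 0 <= mu u) ->
  (forall u, 0 <= x u < X) -> (exists u, x u != 0) ->
  (forall y : G -> R, (forall u, 0 <= y u <= X) ->
     (forall u, x u = 0 -> y u = 0) -> pot mu X K y <= pot mu X K x) ->
  exists2 v, x v != 0 &
    pot mu X K x <= (1 + 2 * (X / K)) * mu v + pot mu X K (del_nbhd v x).
Proof.
move=> Gtf X1 K0 mu0 xX [u0 xu0] xmax.
have flow := pot_flow X1 K0 mu0 xX xmax.
have x0 u : 0 <= x u by case/andP: (xX u).
have xX' u : 0 <= x u <= X by case/andP: (xX u) => -> /ltW ->.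
have X1' := ltW X1.
pose D := nbr_sum x; pose H u := K + D u; pose F := pot_term X K x.
have D0 u : 0 <= D u by exact: nbr_sum_ge0.
have H0 u : 0 < H u by rewrite /H ltr_pwDl.
pose h u := x u * slack X (x u) / H u ^+ 2.
pose E := nbr_sum (fun v => x v * D v).
pose c u v := \sum_(w | adj u w && adj w v) x w.
(* The averaged common-neighbour sum is exactly the derivative of [nbr_sum x u] along the flow, so
   these terms cancel against [pot_flow]. *)
have sumE u : \sum_v x v * c u v = E u.
  transitivity (\sum_v \sum_(w | adj u w) (if adj w v then x v * x w else 0)).
    by apply: eq_bigr => v _; rewrite mulr_sumr big_mkcondr.
  rewrite exchange_big /=; apply: eq_bigr => w uw.
  rewrite -big_mkcond /= mulr_sumr; apply: eq_bigr => v _; exact: mulrC.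
have sumD u : \sum_v x v * ((adj u v)%:R * F u) = D u * F u.
  rewrite /D /nbr_sum big_distrl /= [RHS]big_mkcond /=; apply: eq_bigr => v _.
  by case: (adj u v); rewrite ?mul1r ?mul0r ?mulr0.
have sumd u : \sum_v x v * ((u == v)%:R * (2 * F u)) = 2 * x u * F u.
  rewrite (bigD1 u) //= big1; last by move=> v /negPf vu; rewrite eq_sym vu mul0r mulr0.
  by rewrite eqxx mul1r addr0 mulrCA mulrA.
have main : \sum_v x v * pot mu X K x <=
    \sum_v x v * ((1 + 2 * (X / K)) * mu v + pot mu X K (del_nbhd v x)).
  have lower : \sum_u mu u * (F u * \sum_v x v + h u * E u - D u * F u - 2 * x u * F u)
      <= \sum_v x v * pot mu X K (del_nbhd v x).
    under [leRHS]eq_bigr do rewrite mulr_sumr.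
    rewrite [leRHS]exchange_big /=; apply: ler_sum => u _.
    rewrite -sumE -sumD -sumd !mulr_sumr -big_split -!sumrB /= mulr_sumr.
    apply: ler_sum => v _.
    have := pot_term_del u v Gtf X1' K0 xX'; rewrite -/(F u) -/(c u v) -/(h u) => le1.
    rewrite [leLHS](_ : _ = x v * (mu u * (F u + h u * c u v - (adj u v)%:R * F u
               - (u == v)%:R * (2 * F u)))); last by ring.
    by rewrite ler_wpM2l // ler_wpM2l.
  (* What survives the cancellation is paid for by the picked vertex: [D / H <= 1] and [F <= X / K]
     give the factor [1 + 2 X / K]. *)
  have upper : \sum_u mu u * (x u * D u / H u + 2 * x u * F u) <=
      \sum_v x v * ((1 + 2 * (X / K)) * mu v).
    apply: ler_sum => u _.
    rewrite [leRHS](_ : _ = mu u * (x u * (1 + 2 * (X / K)))); last by ring.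
    rewrite ler_wpM2l //.
    rewrite [leLHS](_ : _ = x u * (D u / H u + 2 * F u)); last by ring.
    rewrite ler_wpM2l // lerD //.
      by rewrite ler_pdivrMr // mul1r /H lerDr ltW.
    by rewrite ler_wpM2l // pot_term_le.
  have total : \sum_u mu u * (F u * \sum_v x v + h u * E u - D u * F u - 2 * x u * F u)
      + \sum_u mu u * (F u * D u - x u * D u / H u - h u * E u)
      + \sum_u mu u * (x u * D u / H u + 2 * x u * F u)
      = \sum_v x v * pot mu X K x.
    rewrite -!big_split /= -mulr_suml /pot mulr_sumr; apply: eq_bigr => u _.
    by rewrite -/(F u); ring.
  rewrite -total; under [leRHS]eq_bigr do rewrite mulrDr.
  rewrite big_split /=; move: flow; rewrite -/D -/F => flow.
  have {}flow : \sum_u mu u * (F u * D u - x u * D u / H u - h u * E u) <= 0 by [].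
  lra.
apply: contrapT => none.
have lt v : x v != 0 -> x v * ((1 + 2 * (X / K)) * mu v + pot mu X K (del_nbhd v x))
    < x v * pot mu X K x.
  move=> xv; have xv0 : 0 < x v by rewrite lt_neqAle eq_sym xv x0.
  by rewrite ltr_pM2l // ltNge; apply/negP => le; apply: none; exists v.
move: main; apply/negP; rewrite -ltNge !(bigD1 (P := xpredT) u0) //=.
apply: ltr_leD; first exact: lt.
apply: ler_sum => v _; have [->|/lt/ltW //] := eqVneq (x v) 0.
by rewrite !mul0r.
Qed.

(** * Maximisers of the potential and induction on the support *)

Lemma cvg_sum_fin {R : realType} {T : Type} {F : set_system T} {FF : Filter F}
    (I : finType) (P : pred I) (f : I -> T -> R) (a : I -> R) :
  (forall i, (f i t @[t --> F] --> a i)%classic) ->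
  (\sum_(i | P i) f i t @[t --> F] --> \sum_(i | P i) a i)%classic.
Proof. by move=> cf; apply: cvg_big => //; exact: add_continuous. Qed.

Lemma pot_cvg {R : realType} {G : sgraph} (mu : G -> R) (X K : R)
    {T : Type} {F : set_system T} {FF : Filter F} (f : T -> G -> R) (x : G -> R) :
  0 < K -> (forall u, 0 <= x u) ->
  (forall u, (f t u @[t --> F] --> x u)%classic) ->
  (pot mu X K (f t) @[t --> F] --> pot mu X K x)%classic.
Proof.
move=> K0 x0 cf.
apply: cvg_sum_fin => u; apply: cvgM; first exact: cvg_cst.
apply: cvgM; first apply: cvgM; first exact: cf.
  apply: cvgB; first exact: cvg_cst.
  have cmax : {for x u, continuous (fun z : R => ln (Num.max z 1))}.
    apply: (@continuous_comp _ _ _ (fun z : R => Num.max z 1) (@ln R)).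
      by apply: continuous_max; [exact: cvg_id | exact: cvg_cst].
    by apply: continuous_ln; rewrite lt_max ltr01 orbT.
  exact: (continuous_cvg _ cmax (cf u)).
apply: cvgV; first by rewrite gt_eqF // ltr_pwDl // nbr_sum_ge0.
by apply: cvgD; [exact: cvg_cst | exact: cvg_sum_fin].
Qed.

Lemma pot_continuous {R : realType} {G : sgraph} (mu : G -> R) (X K : R)
    (x : prod_topology (fun _ : G => R)) :
  0 < K -> (forall u, 0 <= x u) ->
  {for x, continuous (pot mu X K : prod_topology (fun _ : G => R) -> R)}.
Proof.
move=> K0 x0.
have cx u : ((y u : R) @[y --> x] --> (x u : R))%classic.
  exact: (@proj_continuous G (fun _ => R) u x).
exact: (@pot_cvg R G mu X K _ (nbhs x) _ (fun y => y) x K0 x0 cx).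
Qed.

Lemma pot_argmax {R : realType} {G : sgraph} (mu : G -> R) (X K : R) (S : {set G}) :
  0 <= X -> 0 < K ->
  exists x : G -> R, [/\ forall u, 0 <= x u <= X, forall u, u \notin S -> x u = 0 &
    forall y : G -> R, (forall u, 0 <= y u <= X) -> (forall u, u \notin S -> y u = 0) ->
      pot mu X K y <= pot mu X K x].
Proof.
move=> X0 K0.
(* Collapsing the interval to a point outside [S] encodes the support condition in a compact box. *)
pose b (u : G) : R := if u \in S then X else 0.
pose A := [set x : prod_topology (fun _ : G => R) | forall u, `[0, b u]%classic (x u)]%classic.
have Ab (x : G -> R) u : `[0, b u]%classic (x u) -> 0 <= x u <= b u by rewrite /= in_itv.
have cA : compact A.
  by apply: (@tychonoff G (fun=> R) (fun u => `[0, b u]%classic)) => u; exact: segment_compact.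
have A0 : (A !=set0)%classic.
  exists (fun _ => 0) => u /=; rewrite in_itv /= lexx /= /b.
  by case: (u \in S); rewrite ?lexx.
have cf : {within A, continuous (pot mu X K : prod_topology (fun _ : G => R) -> R)}%classic.
  apply: continuous_in_subspaceT => x; rewrite inE => Ax; apply: pot_continuous => // u.
  by case/andP: (Ab _ _ (Ax u)).
have [x] := compact_EVT_max A0 cA cf; rewrite inE => Ax xmax.
exists x; split.
- move=> u; have /andP[-> xb] := Ab _ _ (Ax u); apply: (le_trans xb).
  by rewrite /b; case: (u \in S); rewrite ?lexx.
- move=> u /negPf uS; have := Ab _ _ (Ax u); rewrite /b uS => xu.
  by apply/eqP; rewrite eq_le andbC.
- move=> y yX yS; apply: xmax; rewrite inE => u /=; rewrite in_itv /= /b.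
  by case: ifPn => [_|/yS ->]; rewrite ?lexx ?yX.
Qed.

(** The slack vanishes at [X], so [v] contributes nothing itself and only enlarges the denominators
    of its neighbours. *)
Lemma pot_drop {R : realType} {G : sgraph} (mu : G -> R) (X K : R) (x : G -> R) (v : G) :
  1 <= X -> 0 < K -> (forall u, 0 <= mu u) -> (forall u, 0 <= x u <= X) -> x v = X ->
  pot mu X K x <= pot mu X K (fun u => if u == v then 0 else x u).
Proof.
move=> X1 K0 mu0 xX xv; have x0 w : 0 <= x w by case/andP: (xX w).
apply: ler_sum => u _; rewrite ler_wpM2l // /pot_term.
case: eqP => [->|_]; first by rewrite xv /slack max_l // subrr mulr0 !mul0r.
rewrite ler_wpM2l //.
  by rewrite mulr_ge0 // slack_ge0 //; case/andP: (xX u).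
have y0 w : 0 <= (if w == v then 0 else x w) by case: eqP.
rewrite lef_pV2 ?posrE ?ltr_pwDl ?nbr_sum_ge0 // lerD2l.
by apply: ler_sum => w _; case: eqP.
Qed.

(** Induction on the size of [S], with [x] replaced by a maximiser [z] supported on [S]. A
    coordinate 0 or [X] in [S] lets that vertex leave [S]. Otherwise [pot_pick] gives [v], and the
    set found in [S] minus the closed neighbourhood of [v] stays independent when [v] is added. *)
Lemma pot_le_independent {R : realType} {G : sgraph} (mu : G -> R) (X K : R)
    (S : {set G}) (x : G -> R) :
  triangle_free G -> 1 < X -> 0 < K -> (forall u, 0 <= mu u) ->
  (forall u, 0 <= x u <= X) -> (forall u, u \notin S -> x u = 0) ->
  exists2 I : {set G}, independent I && (I \subset S) &
    pot mu X K x <= (1 + 2 * (X / K)) * \sum_(v in I) mu v.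
Proof.
move=> Gtf X1 K0 mu0; have X1' := ltW X1; have X0 := le_trans ler01 X1'.
elim: {S}_.+1 {-2}S (ltnSn #|S|) x => // n IH S; rewrite ltnS => Sn x xX xS.
have [z [zX zS zmax]] := pot_argmax mu S X0 K0.
suff [I IS le] : exists2 I : {set G}, independent I && (I \subset S) &
    pot mu X K z <= (1 + 2 * (X / K)) * \sum_(v in I) mu v.
  by exists I => //; apply: le_trans le; exact: zmax.
have shrink (y : G -> R) (v : G) : v \in S -> pot mu X K z <= pot mu X K y ->
    (forall u, 0 <= y u <= X) -> (forall u, u \notin S :\ v -> y u = 0) ->
    exists2 I : {set G}, independent I && (I \subset S) &
    pot mu X K z <= (1 + 2 * (X / K)) * \sum_(v in I) mu v.
  move=> vS zy yX yS.
  have lt : (#|S :\ v| < n)%N by rewrite (leq_trans _ Sn) // [in leqRHS](cardsD1 v) vS.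
  have [I /andP[Ii IS] le] := IH _ lt y yX yS.
  by exists I; [rewrite Ii (fintype.subset_trans IS) // finset.subD1set | exact: le_trans le].
have [/existsP[v /andP[vS /orP[/eqP zv|/eqP zv]]]|] :=
    boolP [exists v in S, (z v == 0) || (z v == X)].
- apply: (shrink z v) => // u; rewrite !inE negb_and negbK => /orP[/eqP ->|/zS] //.
- apply: (shrink _ v vS (pot_drop X1' K0 mu0 zX zv)) => u; first by case: eqP; rewrite ?lexx.
  by rewrite !inE negb_and negbK; case: eqP => //= _ /zS.
rewrite negb_exists_in => /forall_inP zint.
have [/eqP S0|/set0Pn[v0 v0S]] := boolP (S == finset.set0).
  exists finset.set0; first by rewrite finset.sub0set andbT; apply/forall_inP => u; rewrite inE.
  rewrite big_set0 mulr0 /pot big1 // => u _.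
  by rewrite /pot_term zS ?S0 ?inE // !mul0r mulr0.
have zlt u : 0 <= z u < X.
  case/andP: (zX u) => -> zu; rewrite lt_neqAle zu andbT /=.
  case: (boolP (u \in S)) => [/zint|/zS ->]; first by rewrite negb_or => /andP[].
  by rewrite lt_eqF // (lt_trans _ X1).
have zne u : u \in S -> z u != 0 by move=> /zint; rewrite negb_or => /andP[].
have zS0 u : z u = 0 -> u \notin S by move=> zu; apply/negP => /zne; rewrite zu eqxx.
have [||v zv0 zle] := @pot_pick R G mu X K z Gtf X1 K0 mu0 zlt.
- by exists v0; exact: zne.
- by move=> y yX yS; apply: zmax => // u /zS /yS.
have vS : v \in S by apply: contraNT zv0 => /zS ->.
pose T := S :\: (v |: [set u | adj u v]%SET).
have lt : (#|T| < n)%N.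
  rewrite (leq_trans _ Sn) // proper_card //; apply/properP; split; first exact: finset.subsetDl.
  by exists v => //; rewrite !inE eqxx.
have [||I /andP[Ii IT] Ile] := IH T lt (del_nbhd v z).
- by move=> u; rewrite /del_nbhd; case: ifP; rewrite ?lexx.
- move=> u; rewrite /del_nbhd !inE negb_and negbK => /orP[->//|/zS ->].
  by case: ifP.
have IvN u : u \in I -> [/\ u != v, ~~ adj u v & u \in S].
  move=> /(fintype.subsetP IT); rewrite !inE negb_or => /andP[/andP[]].
  by split.
have vI : v \notin I by apply/negP => /IvN[]; rewrite eqxx.
exists (v |: I).
  apply/andP; split; last first.
    by rewrite finset.subUset finset.sub1set vS (fintype.subset_trans IT) // finset.subsetDl.
  apply/forall_inP => a; rewrite !inE => aI; apply/forall_inP => c; rewrite !inE => cI.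
  case/orP: aI cI => [/eqP ->|aI] /orP[/eqP ->|cI].
  - by rewrite adj_irrefl.
  - by rewrite adj_sym; case: (IvN _ cI).
  - by case: (IvN _ aI).
  - by move/forall_inP: Ii => /(_ _ aI)/forall_inP; apply.
rewrite big_setU1 //= mulrDr; apply: (le_trans zle).
by rewrite lerD2l.
Qed.

(** * Linear programming duality by least squares *)

Lemma cvg_sqr_pos_part {R : realType} {T : Type} {F : set_system T} {FF : Filter F}
    (f : T -> R) (c a : R) : (f t @[t --> F] --> a)%classic ->
  (Num.max (c - f t) 0 ^+ 2 @[t --> F] --> Num.max (c - a) 0 ^+ 2)%classic.
Proof.
move=> cf.
have cc : {for a, continuous (fun z : R => Num.max (c - z) 0 ^+ 2)}.
  apply: (@continuous_comp _ _ _ (fun z : R => Num.max (c - z) 0) (fun z => z ^+ 2)).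
    apply: continuous_max; last exact: cvg_cst.
    by apply: cvgB; [exact: cvg_cst | exact: cvg_id].
  by apply: cvgM; exact: cvg_id.
exact: (continuous_cvg _ cc cf).
Qed.

Lemma sqr_pos_part_le {R : realType} (a h : R) :
  Num.max (a + h) 0 ^+ 2 <= Num.max a 0 ^+ 2 + 2 * Num.max a 0 * h + h ^+ 2.
Proof.
have a1 : a <= Num.max a 0 by rewrite le_max lexx.
have a0 : 0 <= Num.max a 0 by rewrite le_max lexx orbT.
rewrite [leRHS](_ : _ = (Num.max a 0 + h) ^+ 2); last by ring.
have [ah|ah] := leP (a + h) 0; first by rewrite expr0n sqr_ge0.
by rewrite !expr2 ler_pM //; lra.
Qed.

(* A weight on the vertices is read off from the deficits
   [max (1/r - P(v in I)) 0] of a distribution minimising the sum of their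
   squares. *)
Lemma frac_colorable_duality {R : realType} {G : sgraph} (r : R) :
  1 <= r -> ~ frac_colorable G r ->
  exists mu : G -> R, [/\ forall v, 0 <= mu v, \sum_v mu v = 1 &
    forall I : {set G}, independent I -> \sum_(v in I) mu v <= r^-1].
Proof.
move=> r1 ncol.
pose W := prod_topology (fun _ : {set G} => R).
pose b (I : {set G}) : R := if independent I then 1 else 0.
pose cov (p : {set G} -> R) (v : G) := \sum_(I : {set G} | v \in I) p I.
pose psi (p : {set G} -> R) := - \sum_v Num.max (r^-1 - cov p v) 0 ^+ 2.
pose B := [set p : W | forall I, `[0, b I]%classic (p I)]%classic.
pose A := (B `&` [set p : W | \sum_I p I = 1])%classic.
have csum (p : W) (P : pred {set G}) :
    (\sum_(I | P I) q I @[q --> p] --> \sum_(I | P I) p I)%classic.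
  exact: (@cvg_sum_fin R W (nbhs p) _ _ P (fun I q => q I) p
    (fun I => @proj_continuous {set G} (fun=> R) I p)).
have cpsi : continuous (psi : W -> R).
  move=> p; apply: (@cvgN R R W (nbhs p)).
  apply: (@cvg_sum_fin R W (nbhs p) _ _ xpredT
    (fun v q => Num.max (r^-1 - cov q v) 0 ^+ 2)) => v.
  exact: (@cvg_sqr_pos_part R W (nbhs p) _ (cov^~ v) r^-1 (cov p v)
    (csum p (fun I => v \in I))).
have cB : compact B.
  by apply: (@tychonoff {set G} (fun=> R) (fun I => `[0, b I]%classic)) => I;
     exact: segment_compact.
have cA : compact A.
  apply: (compact_closedI cB).
  apply: (preimage_closed (f := fun p : W => \sum_I p I : R)) (@closed_eq R 1).
  by move=> p _; exact: (csum p xpredT).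
have AE (p : {set G} -> R) : (forall I, 0 <= p I) -> (forall I, ~~ independent I -> p I = 0) ->
    \sum_I p I = 1 -> A p.
  move=> p0 pi p1; split => // I; rewrite /= in_itv /= p0 /= /b.
  case: ifPn => [_|/pi ->]; rewrite ?lexx //.
  by rewrite -p1 (bigD1 I) //= lerDl sumr_ge0.
have ind0 : independent (finset.set0 : {set G}) by apply/forall_inP => u; rewrite inE.
pose dirac (J I : {set G}) : R := (I == J)%:R.
have dirac_sum (J : {set G}) (P : pred {set G}) : \sum_(I | P I) dirac J I = (P J)%:R.
  rewrite big_mkcond (bigD1 J) //= /dirac eqxx big1 ?addr0; first by case: (P J).
  by move=> I /negPf ->; case: ifP.
have A0 : (A !=set0)%classic.
  exists (dirac finset.set0); apply: AE; rewrite ?dirac_sum // => I; rewrite /dirac ?ler0n //.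
  by case: eqP => // ->; rewrite ind0.
have [p] := compact_EVT_max A0 cA (continuous_subspaceT cpsi).
rewrite inE => -[pB p1] pmax; rewrite /= in p1.
have pb I : 0 <= p I <= b I by have := pB I; rewrite /= in_itv.
have p0 I : 0 <= p I by case/andP: (pb I).
have pi I : ~~ independent I -> p I = 0.
  by move=> /negPf nI; have := pb I; rewrite /b nI andbC -eq_le => /eqP.
pose d v := Num.max (r^-1 - cov p v) 0.
have d0 v : 0 <= d v by rewrite le_max lexx orbT.
(* Complementary slackness: [d v] is nonzero only where [cov p v] is below [1 / r]. *)
have dc v : d v * cov p v <= d v * r^-1.
  rewrite /d; have [_|h] := leP (r^-1 - cov p v) 0; first by rewrite !mul0r.
  by rewrite ler_wpM2l ?ltW //; lra.
have ds : 0 < \sum_v d v.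
  rewrite lt_neqAle sumr_ge0 // andbT eq_sym; apply/negP => /eqP sd.
  apply: ncol; split => //; exists [ffun I => p I].
    split => [I|I /pi|]; rewrite ?ffunE //.
    by rewrite -[RHS]p1; apply: eq_bigr => I _; rewrite ffunE.
  move=> v; under eq_bigr do rewrite ffunE; rewrite -subr_le0.
  have dv : d v = 0 by exact: (psumr_eq0P (fun w _ => d0 w) sd).
  have : r^-1 - cov p v <= d v by rewrite le_max lexx.
  by rewrite dv.
(* First-order optimality of [p] in the direction of the point mass at [J]. *)
have dI (J : {set G}) : independent J -> \sum_(v in J) d v <= \sum_v d v * cov p v.
  move=> Ji; pose g v := (v \in J)%:R - cov p v.
  pose N := \sum_v g v ^+ 2; have N0 : 0 <= N by apply: sumr_ge0 => v _; exact: sqr_ge0.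
  suff : \sum_v d v * g v <= 0.
    rewrite /g; under eq_bigr do rewrite mulrBr; rewrite sumrB subr_le0.
    suff -> : \sum_v d v * (v \in J)%:R = \sum_(v in J) d v by [].
    rewrite [RHS]big_mkcond /=; apply: eq_bigr => v _.
    by case: (v \in J); rewrite ?mulr1 ?mulr0.
  rewrite leNgt; apply/negP => a0; set a := \sum_v _ in a0.
  (* This [t] is at most 1, so [q] is a distribution, and satisfies [t N < 2 a], so the linear
     decrease [2 t a] beats the quadratic term [t^2 N]. *)
  pose t := a / (a + N); have aN : 0 < a + N by rewrite ltr_pwDl.
  have t0 : 0 < t by rewrite divr_gt0.
  have t1 : t <= 1 by rewrite ler_pdivrMr // mul1r lerDl.
  have tN : t * N < 2 * a.
    by rewrite /t mulrAC ltr_pdivrMr //; nra.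
  pose q I := (1 - t) * p I + t * dirac J I.
  have Aq : A q.
    apply: AE => [I|I nI|].
    - by rewrite addr_ge0 // mulr_ge0 ?ler0n ?(ltW t0) // subr_ge0.
    - rewrite /q pi // mulr0 add0r /dirac; case: eqP => [eIJ|]; last by rewrite mulr0.
      by rewrite eIJ Ji in nI.
    - by rewrite /q big_split /= -!mulr_sumr p1 dirac_sum !mulr1 subrK.
  have covq v : r^-1 - cov q v = r^-1 - cov p v + (- t * g v).
    by rewrite /cov /q big_split /= -!mulr_sumr dirac_sum /g /cov; ring.
  have := pmax q; rewrite inE => /(_ Aq); rewrite /psi lerN2; apply/negP; rewrite -ltNge.
  apply: (@le_lt_trans _ _ (\sum_v (d v ^+ 2 + 2 * d v * (- t * g v) + (- t * g v) ^+ 2))).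
    by apply: ler_sum => v _; rewrite covq sqr_pos_part_le.
  rewrite !big_split /= -addrA gtrDl.
  have -> : \sum_v 2 * d v * (- t * g v) = - (2 * t) * a.
    by rewrite /a mulr_sumr; apply: eq_bigr => v _; ring.
  have -> : \sum_v (- t * g v) ^+ 2 = t * (t * N).
    by rewrite /N !mulr_sumr; apply: eq_bigr => v _; ring.
  by nra.
exists (fun v => d v / \sum_v d v); split.
- by move=> v; rewrite divr_ge0 // ltW.
- by rewrite -mulr_suml divff // gt_eqF.
- move=> J Ji; rewrite -mulr_suml ler_pdivrMr //; apply: (le_trans (dI J Ji)).
  by rewrite mulr_sumr; apply: ler_sum => v _; rewrite [leRHS]mulrC.
Qed.

(** * Lower bound on the number of edges *)

Lemma sum_degree_le {R : realType} (G : sgraph) :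
  \sum_u nbr_sum (fun _ : G => 1 : R) u <= 2 * #|edges G|%:R.
Proof.
pose f (p : G * G) : {set G} := [set p.1; p.2]%SET.
rewrite /nbr_sum pair_big_dep /= sumr_const -natrM ler_nat.
pose P : pred (G * G) := fun p => adj p.1 p.2.
rewrite -sum1_card (partition_big f (mem (edges G))) /=; last first.
  by move=> p pP; rewrite /edges; apply/imsetP; exists p; rewrite ?inE.
rewrite mulnC -sum_nat_const; apply: leq_sum => _ /imsetP[p _ ->].
(* Only an ordered pair and its reversal span the same edge, whence the factor 2. *)
rewrite sum1_card (@leq_trans #|[set p; (p.2, p.1)]%SET|) //; last first.
  by rewrite cards2; case: (_ != _).
apply: subset_leq_card; apply/fintype.subsetP => -[a b].
rewrite inE => /andP[ab /eqP/setP e]; rewrite !inE.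
have {}ab : adj a b by [].
have : a != b by apply: contraTneq ab => ->; rewrite adj_irrefl.
have := e a; have := e b; rewrite !inE !eqxx orbT /=.
case: p {e} => c d /= /esym/orP[] /eqP -> /esym/orP[] /eqP ->; rewrite ?eqxx ?orbT //.
Qed.

(** AM-GM for [y^2], [y / z] and [z], whose product is [y^3]. Multiplying by [z] leaves a quadratic
    in [y]: its coefficients are nonnegative for [z <= 1/4], and completing the square settles the
    rest. *)
Lemma amgm3 {R : realType} (y z : R) : 0 <= y -> 0 < z -> 3 * y <= y ^+ 2 + y / z + z.
Proof.
move=> y0 z0.
suff h : 0 <= z * y ^+ 2 + (1 - 3 * z) * y + z ^+ 2.
  rewrite -subr_ge0 (_ : _ - _ = (z * y ^+ 2 + (1 - 3 * z) * y + z ^+ 2) / z).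
    by rewrite divr_ge0 // ltW.
  by field; rewrite gt_eqF.
have [z1|z1] := leP z (1 / 4).
  have ? := sqr_ge0 y; have ? := sqr_ge0 z; nra.
rewrite -(@pmulr_rge0 _ (4 * z)); last by lra.
rewrite [leRHS](_ : _ = (2 * z * y + 1 - 3 * z) ^+ 2 + (1 - z) ^+ 2 * (4 * z - 1)); last by ring.
by rewrite addr_ge0 ?sqr_ge0 // mulr_ge0 ?sqr_ge0 //; lra.
Qed.

(** For [x <= 1] every slack equals [ln X], so the potential is [ln X] times the left side. *)
Lemma weighted_shearer {R : realType} {G : sgraph} (mu : G -> R) (X K a : R) (x : G -> R) :
  triangle_free G -> 1 < X -> 0 < K -> (forall u, 0 <= mu u) ->
  (forall I : {set G}, independent I -> \sum_(v in I) mu v <= a) ->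
  (forall u, 0 <= x u <= 1) ->
  \sum_u mu u * x u / (K + nbr_sum x u) <= (1 + 2 * (X / K)) * a / ln X.
Proof.
move=> Gtf X1 K0 mu0 mua x1; have lX := ln_gt0 X1.
have xX u : 0 <= x u <= X.
  by case/andP: (x1 u) => -> /le_trans -> //; exact: ltW.
have [|I /andP[Ii _] le] := @pot_le_independent R G mu X K [set: G]%SET x Gtf X1 K0 mu0 xX.
  by move=> u; rewrite inE.
rewrite ler_pdivlMr // mulr_suml.
rewrite (_ : \sum_u _ = pot mu X K x); last first.
  by apply: eq_bigr => u _; rewrite /pot_term slack_le1 ?mulrA //; [ring | case/andP: (x1 u)].
apply: (le_trans le); rewrite ler_wpM2l ?mua // addr_ge0 // mulr_ge0 // divr_ge0 ?(ltW K0) //.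
by apply: ltW; exact: lt_trans X1.
Qed.

(* The product form of Hölder's inequality is replaced by its pointwise AM-GM
   version [amgm3], in which the vertices with large [mu u] or small degree are
   absorbed by the terms of lower order. *)
Lemma edges_lower_bound {R : realType} {G : sgraph} (mu : G -> R) (rho e : R) :
  triangle_free G -> (forall u, 0 <= mu u) -> \sum_u mu u = 1 ->
  (forall I : {set G}, independent I -> \sum_(v in I) mu v <= rho^-1) ->
  0 < rho -> 0 < e <= 1 / 10 -> 1 <= ln (e ^+ 4 * rho) ->
  (1 - 7 * e) * (rho ^+ 3 * ln (e ^+ 4 * rho) ^+ 2) <= (1 + e) * (2 * #|edges G|%:R).
Proof.
move=> Gtf mu0 mu1 mui rho0 /andP[e0 e1] L1.
set X := e ^+ 4 * rho; set L := ln X in L1 *.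
(* [X / K = e] makes the Shearer factor [1 + 2 e]; [c / rho = e^2 rho] bounds [nbr_sum x], and [K]
   is [e] times that bound. *)
pose K := e ^+ 3 * rho; pose c := e ^+ 2 * rho ^+ 2.
have K0 : 0 < K by rewrite mulr_gt0 // exprn_gt0.
have c0 : 0 < c by rewrite mulr_gt0 // exprn_gt0.
have L0 : 0 <= L by lra.
have en : e != 0 by rewrite gt_eqF.
have rn : rho != 0 by rewrite gt_eqF.
have Ln : L != 0 by rewrite gt_eqF //; exact: lt_le_trans L1.
have X1 : 1 < X by rewrite ltNge; apply/negP => /ln_le0; rewrite -/L; lra.
have XK : X / K = e by rewrite /X /K; field; rewrite en rn.
pose x u := Num.min 1 (c * mu u).
pose d u := nbr_sum (fun _ : G => 1 : R) u.
have d0 u : 0 <= d u by exact: nbr_sum_ge0.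
have x01 u : 0 <= x u <= 1 by rewrite le_min ler01 mulr_ge0 ?(ltW c0) // ge_min lexx.
have muN u : nbr_sum mu u <= rho^-1.
  apply: (le_trans _ (mui [set v | adj u v]%SET _)).
    by rewrite /nbr_sum le_eqVlt; apply/orP; left; apply/eqP/eq_bigl => v; rewrite inE.
  apply/forall_inP => a; rewrite inE => ua; apply/forall_inP => b; rewrite inE => ub.
  by apply/negP => ab; apply: (Gtf u a b).
have xN u : nbr_sum x u <= e ^+ 2 * rho.
  apply: (@le_trans _ _ (c * nbr_sum mu u)).
    by rewrite /nbr_sum mulr_sumr; apply: ler_sum => v _; rewrite ge_min lexx orbT.
  rewrite (_ : e ^+ 2 * rho = c * rho^-1); last by rewrite /c; field.
  by rewrite ler_wpM2l // ltW.
have KE : K + e ^+ 2 * rho = e ^+ 2 * rho * (1 + e) by rewrite /K; ring.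
have er0 : 0 < e ^+ 2 * rho by rewrite mulr_gt0 // exprn_gt0.
have sumA : \sum_u mu u * x u <= (1 + 2 * e) * (1 + e) * e ^+ 2 / L.
  have := weighted_shearer Gtf X1 K0 mu0 mui x01; rewrite XK -/L => le.
  rewrite (_ : (1 + 2 * e) * (1 + e) * e ^+ 2 / L =
    (1 + 2 * e) * rho^-1 / L * (e ^+ 2 * rho * (1 + e))); last by field; rewrite Ln rn.
  rewrite -ler_pdivrMr ?mulr_gt0 //; last by lra.
  apply: le_trans le; rewrite mulr_suml; apply: ler_sum => u _.
  have x0u : 0 <= x u by case/andP: (x01 u).
  have n0 : 0 <= nbr_sum x u by apply: nbr_sum_ge0 => v; case/andP: (x01 v).
  rewrite ler_wpM2l ?mulr_ge0 // lef_pV2 ?posrE ?mulr_gt0 ?ltr_pwDl //; last by lra.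
  by rewrite -KE lerD2l.
have sumB : \sum_u mu u / (K + d u) <= (1 + 2 * e) / (rho * L).
  have := @weighted_shearer R G mu X K _ (fun=> 1) Gtf X1 K0 mu0 mui.
  rewrite XK -/L => le.
  rewrite (_ : (1 + 2 * e) / (rho * L) = (1 + 2 * e) * rho^-1 / L); last by field; rewrite Ln rn.
  apply: le_trans (le _); last by move=> u; rewrite ler01 lexx.
  by apply: ler_sum => u _; rewrite mulr1.
have point u : 3 * mu u <= (L / e ^+ 2 + 3) * (mu u * x u)
    + (rho * L + 3 * (e ^+ 2 * rho * (1 + e))) * (mu u / (K + d u))
    + (1 + e) / (rho ^+ 3 * L ^+ 2) * d u.
  have m0 := mu0 u; have D0 := d0 u; set D := d u in D0 *.
  have KD : 0 < K + D by rewrite ltr_pwDl.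
  have x0u : 0 <= x u by case/andP: (x01 u).
  have le0 : 0 <= L / e ^+ 2 by rewrite divr_ge0 ?sqr_ge0 //.
  have t1 : 0 <= (L / e ^+ 2 + 3) * (mu u * x u) by rewrite !mulr_ge0 // addr_ge0.
  have rL0 : 0 <= rho * L by rewrite mulr_ge0 // ltW.
  have t2 : 0 <= mu u / (K + D) by rewrite divr_ge0 // ltW.
  have s2 : 0 <= 3 * (e ^+ 2 * rho * (1 + e)) by rewrite !mulr_ge0 ?sqr_ge0 ?(ltW rho0) //; lra.
  have t3 : 0 <= (1 + e) / (rho ^+ 3 * L ^+ 2) * D.
    by rewrite mulr_ge0 // divr_ge0 ?mulr_ge0 ?exprn_ge0 ?(ltW rho0) //; lra.
  (* Large [mu u] means [x u = 1], and the summand 3 of the first coefficient suffices. *)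
  have [cm|cm] := ltP 1 (c * mu u).
    have xu : x u = 1 by rewrite /x min_l // ltW.
    have : 0 <= (rho * L + 3 * (e ^+ 2 * rho * (1 + e))) * (mu u / (K + D)).
      by rewrite mulr_ge0 // addr_ge0.
    have : 0 <= L / e ^+ 2 * mu u by rewrite mulr_ge0.
    by rewrite xu mulr1 mulrDl; lra.
  have xu : x u = c * mu u by rewrite /x min_r.
  (* For small degree, [K + D <= e^2 rho (1 + e)], and the lower-order part of the second
     coefficient suffices. *)
  have [Dlow|Dhigh] := ltP D (e ^+ 2 * rho).
    have : 3 * mu u <= 3 * (e ^+ 2 * rho * (1 + e)) * (mu u / (K + D)).
      have : (K + D) * (mu u / (K + D)) <= e ^+ 2 * rho * (1 + e) * (mu u / (K + D)).
        by rewrite ler_wpM2r // -KE lerD2l ltW.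
      by rewrite mulrCA divff ?gt_eqF // mulr1; lra.
    have : 0 <= rho * L * (mu u / (K + D)) by rewrite mulr_ge0.
    by rewrite (mulrDl (rho * L)); lra.
  have r2L : 0 < rho ^+ 2 * L by rewrite mulr_gt0 ?exprn_gt0 //; lra.
  have y0 : 0 <= rho ^+ 2 * L * mu u by rewrite mulr_ge0 // ltW.
  have z0 : 0 < (K + D) / (rho * L) by rewrite divr_gt0 // mulr_gt0 //; lra.
  (* With [y = rho^2 L mu u] and [z = (K + D) / (rho L)], the three terms divided by [rho^2 L] are
     the three required summands; large degree gives [K <= e D]. *)
  have := amgm3 y0 z0.
  rewrite (_ : 3 * (rho ^+ 2 * L * mu u) = rho ^+ 2 * L * (3 * mu u)); last by ring.
  rewrite [leRHS](_ : _ = rho ^+ 2 * L * (L / e ^+ 2 * (mu u * x u)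
      + rho * L * (mu u / (K + D)) + (K + D) / (rho ^+ 3 * L ^+ 2))); last first.
    by rewrite xu /c; field; rewrite en rn Ln gt_eqF.
  rewrite ler_pM2l // => am; apply: (le_trans am).
  rewrite lerD //; last first.
    rewrite [leRHS]mulrAC ler_wpM2r ?invr_ge0 ?mulr_ge0 ?exprn_ge0 ?(ltW rho0) //.
    have : K <= e * D by rewrite /K exprS -mulrA ler_wpM2l // ltW.
    by lra.
  by apply: lerD; apply: ler_wpM2r; rewrite ?lerDl // mulr_ge0.
have Q0 : 0 < rho ^+ 3 * L ^+ 2 by rewrite mulr_gt0 ?exprn_gt0 //; lra.
have : \sum_u 3 * mu u <= (L / e ^+ 2 + 3) * (\sum_u mu u * x u)
    + (rho * L + 3 * (e ^+ 2 * rho * (1 + e))) * (\sum_u mu u / (K + d u))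
    + (1 + e) / (rho ^+ 3 * L ^+ 2) * \sum_u d u.
  rewrite !mulr_sumr -!big_split /=; exact: ler_sum.
rewrite -mulr_sumr mu1 mulr1 => tot.
have w1 : L^-1 <= 1 by rewrite invf_le1 //; lra.
have w0 : 0 <= L^-1 by rewrite invr_ge0; lra.
have hA : (L / e ^+ 2 + 3) * (\sum_u mu u * x u)
    <= (1 + 2 * e) * (1 + e) * (1 + 3 * e ^+ 2 * L^-1).
  rewrite (_ : (1 + 2 * e) * (1 + e) * (1 + 3 * e ^+ 2 * L^-1) =
     (L / e ^+ 2 + 3) * ((1 + 2 * e) * (1 + e) * e ^+ 2 / L)); last by field; rewrite Ln en.
  by rewrite ler_wpM2l // addr_ge0 // divr_ge0 ?sqr_ge0 //; lra.
have hB : (rho * L + 3 * (e ^+ 2 * rho * (1 + e))) * (\sum_u mu u / (K + d u))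
    <= (1 + 2 * e) * (1 + 3 * e ^+ 2 * (1 + e) * L^-1).
  rewrite (_ : (1 + 2 * e) * (1 + 3 * e ^+ 2 * (1 + e) * L^-1) =
     (rho * L + 3 * (e ^+ 2 * rho * (1 + e))) * ((1 + 2 * e) / (rho * L))); last first.
    by field; rewrite Ln rn.
  rewrite ler_wpM2l // addr_ge0 // ?mulr_ge0 ?sqr_ge0 ?(ltW rho0) //; lra.
have hC : (1 + e) / (rho ^+ 3 * L ^+ 2) * \sum_u d u
    <= (1 + e) * (2 * #|edges G|%:R) / (rho ^+ 3 * L ^+ 2).
  rewrite [leLHS]mulrAC ler_wpM2r ?invr_ge0 ?(ltW Q0) // ler_wpM2l ?sum_degree_le //; lra.
have e2 : e ^+ 2 * L^-1 <= e / 10.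
  apply: (@le_trans _ _ (e ^+ 2)); first by rewrite ler_piMr ?sqr_ge0.
  by rewrite expr2 ler_wpM2l ?(ltW e0) //; lra.
have e20 : 0 <= e ^+ 2 * L^-1 by rewrite mulr_ge0 ?sqr_ge0.
(* The first two sums use up [2 + 7 e] of the total 3, leaving [1 - 7 e] for the degree sum. *)
have hA' : (1 + 2 * e) * (1 + e) * (1 + 3 * e ^+ 2 * L^-1) <= 1 + 4 * e.
  rewrite -(mulrA 3); set w := e ^+ 2 * L^-1 in e2 e20 *. nra.
have hB' : (1 + 2 * e) * (1 + 3 * e ^+ 2 * (1 + e) * L^-1) <= 1 + 3 * e.
  rewrite (_ : 3 * e ^+ 2 * (1 + e) * L^-1 = 3 * (1 + e) * (e ^+ 2 * L^-1)); last by ring.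
  set w := e ^+ 2 * L^-1 in e2 e20 *. nra.
rewrite -ler_pdivlMr //; lra.
Qed.

(** * Asymptotics and the theorem *)

Lemma ln_lower_bound {R : realType} (e : R) : 0 < e ->
  exists T0 : R, forall q T : R, 1 <= q -> T0 <= T -> 0 < T ->
    (1 - e) * T / 3 <= ln (e ^+ 4) + ln q + T / 3 - 2 / 3 * ln T.
Proof.
move=> e0; have e40 : 0 < e / 4 by rewrite divr_gt0.
(* Of the allowance [e T / 3], one half absorbs [2/3 ln T] through [ln (e T / 4) < e T / 4]; this
   threshold lets the other half absorb the constants. *)
exists (6 / e * (- (2 / 3) * ln (e / 4) - ln (e ^+ 4))) => q T q1 T0 Tpos.
have lq := ln_ge0 q1.
have lnT : ln (e / 4) + ln T < e / 4 * T.
  by rewrite -lnM ?posrE //; apply: ln_sublinear; rewrite mulr_gt0.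
have : - (2 / 3) * ln (e / 4) - ln (e ^+ 4) <= e / 6 * T.
  rewrite -ler_pdivrMl; last by rewrite divr_gt0.
  by rewrite invf_div.
by lra.
Qed.

Lemma powR_third_expn3 {R : realType} (a : R) : 0 <= a -> (a `^ 3^-1) ^+ 3 = a.
Proof.
move=> a0; rewrite -powR_mulrn ?powR_ge0 // -powRrM mulVf ?powRr1 //.
by rewrite pnatr_eq0.
Qed.

Theorem theorem1p5 (R : realType) (delta : R) (hdelta : 0 < delta) :
  exists m0 : nat, forall G : sgraph, triangle_free G ->
    (m0 <= #|edges G|)%N ->
    chi_f R G <= (18 `^ (3^-1) + delta) *
      ((#|edges G|%:R `^ (3^-1)) / ((ln #|edges G|%:R) `^ (2 / 3))).
Proof.
pose e : R := Num.min delta 1 / 100.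
have e0 : 0 < e by rewrite divr_gt0 // lt_min hdelta ltr01.
have e1 : e <= 1 / 100.
  have : Num.min delta 1 <= 1 by rewrite ge_min lexx orbT.
  by rewrite /e; lra.
have ed : 100 * e <= delta.
  have : Num.min delta 1 <= delta by rewrite ge_min lexx.
  by rewrite /e; lra.
have [T0 hT0] := ln_lower_bound e0.
(* [T >= 4] ensures [L >= (1 - e) T / 3 >= 1]. *)
pose T1 := Num.max T0 4.
exists (Num.bound (expR T1)) => G Gtf hm.
set m : R := #|edges G|%:R.
have mT : expR T1 <= m.
  apply: (@le_trans _ _ (Num.bound (expR T1))%:R); last by rewrite ler_nat.
  by apply: ltW; apply: archi_boundP; exact: expR_ge0.
have m0 : 0 < m by apply: lt_le_trans mT; exact: expR_gt0.
pose T := ln m.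
have TT : T1 <= T by rewrite -(expRK T1) ler_ln ?posrE ?expR_gt0.
have [T4 T00] : 4 <= T /\ T0 <= T.
  by move: TT; rewrite ge_max => /andP[-> ->].
have Tpos : 0 < T by lra.
pose s : R := 18 `^ 3^-1; pose q := s + delta.
have s3 : s ^+ 3 = 18 by exact: powR_third_expn3.
have s1 : 1 <= s.
  rewrite leNgt; apply/negP => s1.
  have : s ^+ 3 <= 1 by rewrite exprn_ile1 ?powR_ge0 // ltW.
  by rewrite s3; lra.
have q1 : 1 <= q by rewrite /q; lra.
(* As [s >= 1], the cross term [3 s^2 delta] is at least [3 delta >= 300 e]. *)
have q3 : 18 + 300 * e <= q ^+ 3.
  rewrite (_ : q ^+ 3 = s ^+ 3 + 3 * s ^+ 2 * delta + 3 * s * delta ^+ 2 + delta ^+ 3);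
    last by rewrite /q; ring.
  rewrite s3.
  have : 3 * delta <= 3 * s ^+ 2 * delta.
    by rewrite ler_pM2r // ler_peMr // exprn_ege1.
  have : 0 <= 3 * s * delta ^+ 2 by rewrite !mulr_ge0 ?sqr_ge0 //; lra.
  have : 0 <= delta ^+ 3 by rewrite exprn_ge0 // ltW.
  lra.
set rho := (_ + _) * _.
have rhoE : rho = q * (m `^ 3^-1 / T `^ (2 / 3)) by [].
have m3 : 0 < m `^ 3^-1 by exact: powR_gt0.
have T3 : 0 < T `^ (2 / 3) by exact: powR_gt0.
have rho0 : 0 < rho by rewrite rhoE mulr_gt0 ?divr_gt0 //; lra.
have rho3 : rho ^+ 3 = q ^+ 3 * (m / T ^+ 2).
  rewrite rhoE exprMn expr_div_n powR_third_expn3 ?(ltW m0) //; congr (_ * (_ / _)).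
  rewrite -(@powR_mulrn _ (T `^ (2 / 3))) ?powR_ge0 // -powRrM divfK ?pnatr_eq0 //.
  by rewrite powR_mulrn // ltW.
pose L := ln (e ^+ 4 * rho).
have LE : L = ln (e ^+ 4) + ln q + T / 3 - 2 / 3 * ln T.
  rewrite /L lnM ?posrE ?exprn_gt0 // rhoE lnM ?posrE ?divr_gt0 //; last by lra.
  by rewrite ln_div ?posrE // !ln_powR -/T; ring.
have Lge : (1 - e) * T / 3 <= L by rewrite LE; exact: hT0.
have L1 : 1 <= L by nra.
have rho1 : 1 <= rho.
  have e4 : e ^+ 4 <= 1 by rewrite exprn_ile1 //; lra.
  have : 1 < e ^+ 4 * rho by rewrite ltNge; apply/negP => /ln_le0; rewrite -/L; lra.
  by nra.
suff col : frac_colorable G rho by exact: (chi_f_min R G).2.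
apply: contrapT => ncol.
have [mu [mu0 mu1 mui]] := frac_colorable_duality rho1 ncol.
have e10 : 0 < e <= 1 / 10 by rewrite e0 /=; lra.
have := edges_lower_bound Gtf mu0 mu1 mui rho0 e10 L1.
apply/negP; rewrite -ltNge -/L -/m rho3.
have L2 : ((1 - e) * T / 3) ^+ 2 <= L ^+ 2.
  by rewrite lerXn2r ?nnegrE //; [rewrite divr_ge0 ?mulr_ge0 //; lra | lra].
(* The powers of [T] cancel and [18 / 9 = 2] matches the [2 m]. To first order in [e], the
   coefficients of [m] are [2 + 2 e] against [2 - 18 e + (300 / 9) e]. *)
apply: (@lt_le_trans _ _ ((1 - 7 * e) * ((18 + 300 * e) * (m / T ^+ 2) * ((1 - e) * T / 3) ^+ 2))).
  rewrite [ltRHS](_ : _ = m * ((1 - 7 * e) * (18 + 300 * e) * (1 - e) ^+ 2 / 9)); last first.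
    by field; rewrite gt_eqF.
  rewrite [ltLHS](_ : _ = m * ((1 + e) * 2)); last by ring.
  by rewrite ltr_pM2l //; nra.
rewrite ler_wpM2l //; first by lra.
have mT2 : 0 <= m / T ^+ 2 by rewrite divr_ge0 ?sqr_ge0 // ltW.
rewrite ler_pM ?sqr_ge0 //; last by rewrite ler_wpM2r.
by rewrite mulr_ge0 //; lra.
Qed.
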